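(* There is no Schauder-Orlicz decomposition $\{\mathfrak{M}_n\}_{n=0}^{\infty}$ of the space $C=C[0,1]$ such that at least one of the subspaces $\mathfrak{M}_n$ is finite dimensional.
   Context: $C[0,1]$ is the space of continuous functions on $[0,1]$ with the supremum norm. A Schauder decomposition of a Banach space $X$ is a sequence $\{\mathfrak{M}_n\}_{n=0}^{\infty}$ of closed nonzero linear subspaces of $X$ such that each $x\in X$ has a unique norm convergent expansion $x=\sum_{n=0}^{\infty}x_n$ with $x_n\in\mathfrak{M}_n$ for all $n$. Its associated sequence of coordinate projections (a.s.c.p.) $\{P_n\}_{n=0}^{\infty}$ is defined by $P_nx=x_n$; each $P_n$ is bounded. An Orlicz function is a continuous, nondecreasing, convex function $\Phi:[0,\infty)\to[0,\infty)$ with $\Phi(0)=0$ and $\lim_{t\to\infty}\Phi(t)=\infty$ (it may be degenerate, i.e. $\Phi(t)=0$ for some $t>0$). A Schauder decomposition of $X$ with a.s.c.p. $\{P_n\}$ is a Schauder-Orlicz decomposition (with Orlicz function $\Phi$) if there exists an Orlicz function $\Phi$ such that for every $x\in X$: $\inf\{\rho>0:\sum_{n=0}^{\infty}\Phi(\|P_nx\|/\rho)\le 1\}=\|x\|$. *)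

(* Defs.v *)
From HB Require Import structures.
From mathcomp Require Import all_boot all_order all_algebra.
From mathcomp Require Import all_classical all_reals all_analysis.
From mathcomp Require Import ring.

Set Implicit Arguments.
Unset Strict Implicit.
Unset Printing Implicit Defensive.

Import Order.TTheory GRing.Theory Num.Theory.
Import numFieldNormedType.Exports.

Local Open Scope classical_set_scope.
Local Open Scope ring_scope.

(* [set_type A] is the set [A] as a type, with the topology induced by [R];
   unlike [{within A, continuous f}], it leaves no values outside [A]. *)
Definition unit_interval (R : realType) : Type := set_type `[0 : R, 1].
HB.instance Definition _ (R : realType) :=
  PseudoMetric.copy (unit_interval R) (set_type `[0 : R, 1]%classic).

Record C01 (R : realType) : Type := C01_of {
  C01_fun :> unit_interval R -> R;
  C01_continuous : continuous C01_fun }.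

HB.instance Definition _ (R : realType) := gen_eqMixin (C01 R).
HB.instance Definition _ (R : realType) := gen_choiceMixin (C01 R).

Section C01_lmodule.
Context {R : realType}.
Notation C := (C01 R).
Implicit Types (f g h : C) (a b : R) (x : unit_interval R).

Lemma C01P f g : (forall x, f x = g x) -> f = g.
Proof.
case: f g => f cf [g cg] /= /funext fg; rewrite fg in cf *.
by congr C01_of; exact: Prop_irrelevance.
Qed.

Let zero_cts : continuous (fun _ : unit_interval R => 0 : R).
Proof. exact: cst_continuous. Qed.

Let add_cts f g : continuous (fun x => f x + g x).
Proof. by move=> x; exact: (continuousD (@C01_continuous _ f x) (@C01_continuous _ g x)). Qed.

Let opp_cts f : continuous (fun x => - f x).
Proof. by move=> x; exact: (continuousN (@C01_continuous _ f x)). Qed.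

Let scale_cts a f : continuous (fun x => a * f x).
Proof. by move=> x; exact: (continuousM (@cst_continuous _ _ a x) (@C01_continuous _ f x)). Qed.

Definition C01_zero : C := C01_of (@zero_cts).
Definition C01_add f g : C := C01_of (@add_cts f g).
Definition C01_opp f : C := C01_of (@opp_cts f).
Definition C01_scale a f : C := C01_of (@scale_cts a f).

Let addA : associative C01_add.
Proof. by move=> f g h; apply: C01P => x; exact: addrA. Qed.
Let addC : commutative C01_add.
Proof. by move=> f g; apply: C01P => x; exact: addrC. Qed.
Let add0 : left_id C01_zero C01_add.
Proof. by move=> f; apply: C01P => x; exact: add0r. Qed.
Let addN : left_inverse C01_zero C01_opp C01_add.
Proof. by move=> f; apply: C01P => x; exact: addNr. Qed.

HB.instance Definition _ := GRing.isZmodule.Build C addA addC add0 addN.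

Let scaleA a b f : C01_scale a (C01_scale b f) = C01_scale (a * b) f.
Proof. by apply: C01P => x; exact: mulrA. Qed.
Let scale1 : left_id 1 C01_scale.
Proof. by move=> f; apply: C01P => x; exact: mul1r. Qed.
Let scaleDr : right_distributive C01_scale +%R.
Proof. by move=> a f g; apply: C01P => x; exact: mulrDr. Qed.
Let scaleDl f : {morph C01_scale^~ f : a b / a + b}.
Proof. by move=> a b; apply: C01P => x; exact: mulrDl. Qed.

HB.instance Definition _ :=
  GRing.Zmodule_isLmodule.Build R C scaleA scale1 scaleDr scaleDl.

Lemma C01_zeroE x : (0 : C) x = 0. Proof. by []. Qed.
Lemma C01_addE f g x : (f + g) x = f x + g x. Proof. by []. Qed.
Lemma C01_oppE f x : (- f) x = - f x. Proof. by []. Qed.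
Lemma C01_scaleE a f x : (a *: f) x = a * f x. Proof. by []. Qed.

End C01_lmodule.

Section C01_norm.
Context {R : realType}.
Notation C := (C01 R).
Implicit Types (f g h : C) (a b : R) (x : unit_interval R).

Definition C01_norm f : R := sup (range (fun x => `|f x|)).

Let zero_in : (0 : R) \in `[0 : R, 1]%classic.
Proof. by rewrite inE/= in_itv/= lexx ler01. Qed.

Definition unit_interval0 : unit_interval R := SigSub zero_in.

Lemma C01_has_sup f : has_sup (range (fun x => `|f x|)).
Proof.
split; first by exists `|f unit_interval0|, unit_interval0.
have /compact_bounded[M [_ HM]] : compact (range (f : unit_interval R -> R)).
  rewrite -(valLK (0 : R) (f : `[0 : R, 1]%classic -> R)).
  rewrite (_ : range _ = valL_ (0 : R) (f : `[0 : R, 1]%classic -> R)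
      @` `[0 : R, 1]%classic).
    apply: continuous_compact; last exact: segment_compact.
    by apply/subspace_valL_continuousP'; exact: C01_continuous.
  apply/seteqP; split=> [_ [x _ <-]|_ [x x01 <-]].
    by exists (set_val x) => //; exact: set_valP.
  by exists (SigSub (mem_set x01)).
exists (M + 1) => _ [x _ <-]; apply: (HM (M + 1)); first by rewrite ltrDl.
by exists x.
Qed.

Lemma C01_norm_ub f x : `|f x| <= C01_norm f.
Proof.
by apply: sup_upper_bound; [exact: C01_has_sup|exists x].
Qed.

Lemma C01_norm_le f a : (forall x, `|f x| <= a) -> C01_norm f <= a.
Proof.
move=> fa; apply: ge_sup; first by case: (C01_has_sup f).
by move=> _ [x _ <-].
Qed.

Let normD f g : C01_norm (f + g) <= C01_norm f + C01_norm g.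
Proof.
apply: C01_norm_le => x; apply: (le_trans (ler_normD _ _)).
by apply: lerD; exact: C01_norm_ub.
Qed.

Let normZ a f : C01_norm (a *: f) = `|a| * C01_norm f.
Proof.
apply/eqP; rewrite eq_le; apply/andP; split.
  apply: C01_norm_le => x; rewrite C01_scaleE normrM.
  by apply: ler_wpM2l => //; exact: C01_norm_ub.
have [->|a0] := eqVneq a 0.
  rewrite normr0 mul0r.
  exact: le_trans (normr_ge0 _) (C01_norm_ub _ unit_interval0).
rewrite mulrC -ler_pdivlMr ?normr_gt0//; apply: C01_norm_le => x.
rewrite ler_pdivlMr ?normr_gt0// mulrC -normrM -C01_scaleE.
exact: C01_norm_ub.
Qed.

Let norm0_eq0 f : C01_norm f = 0 -> f = 0.
Proof.
move=> f0; apply: C01P => x; apply/eqP; rewrite C01_zeroE -normr_le0 -f0.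
exact: C01_norm_ub.
Qed.

HB.instance Definition _ := Lmodule_isNormed.Build R C normD normZ norm0_eq0.

Lemma C01_normE f : `|f| = sup (range (fun x => `|f x|)).
Proof. by []. Qed.

Lemma C01_complete (F : set_system C) : ProperFilter F -> cauchy F -> cvg F.
Proof.
move=> FF Fc.
have Fe (e : R) : 0 < e -> exists f, \forall h \near F, `|f - h| < e.
  by move=> e0; exact: ((cauchyP F).1 Fc).
have ptwise x (f h : C) : `|f x - h x| <= `|f - h| by exact: (C01_norm_ub (f - h) x).
have cvx x : cvg ((fun f : C => f x) @ F).
  apply: cauchy_cvg; apply/cauchyP => e e0.
  have [f fF] := Fe e e0; exists (f x).
  by apply: filterS fF => h; exact: le_lt_trans (ptwise x f h).
pose g x : R := lim ((fun f : C => f x) @ F).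
have gF (e : R) : 0 < e -> F [set f : C | forall x, `|f x - g x| <= e].
  move=> e0; have [f0 f0F] := Fe (e / 2) (divr_gt0 e0 (ltr0n _ 2)).
  apply: filterS (f0F) => f ff0 x.
  have cvn : (fun h : C => `|f0 x - h x|) @ F --> `|f0 x - g x|.
    exact: (cvg_norm (cvgB (cvg_cst (f0 x)) (cvx x))).
  have f0g : `|f0 x - g x| <= e / 2.
    rewrite -(cvg_lim (@Rhausdorff R) cvn); apply: limr_le.
      by apply/cvg_ex; exists `|f0 x - g x|.
    by apply: filterS f0F => h f0h; exact/ltW/(le_lt_trans (ptwise x f0 h)).
  rewrite -(subrK (f0 x) (f x)) -addrA (le_trans (ler_normD _ _))//.
  rewrite [leRHS]splitr; apply: lerD => //; rewrite distrC.
  exact/ltW/(le_lt_trans (ptwise x f0 f)).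
have cg : continuous g.
  move=> x; apply/(@cvgrPdist_le _ _ _ (nbhs x) (nbhs_filter x)) => e e0.
  have e3 : 0 < e / 3 by rewrite divr_gt0.
  have [f fg] := filter_ex (gF _ e3).
  have /(@cvgrPdist_le _ _ _ (nbhs x) (nbhs_filter x))/(_ _ e3) fx :=
    @C01_continuous R f x.
  apply: (@filterS _ (nbhs x) (nbhs_filter x) _ _ _ fx) => y fxy.
  have -> : g x - g y = (g x - f x) + (f x - f y) + (f y - g y) by ring.
  have -> : e = e / 3 + e / 3 + e / 3 by field.
  apply: (le_trans (ler_normD _ _)); apply: lerD => //.
  by apply: (le_trans (ler_normD _ _)); apply: lerD => //; rewrite distrC.
apply/cvg_ex; exists (C01_of cg); apply/cvgrPdist_le => e e0.
apply: filterS (gF e e0) => f fg; apply: C01_norm_le => x.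
by rewrite C01_addE C01_oppE distrC.
Qed.

HB.instance Definition _ := Uniform_isComplete.Build C C01_complete.

End C01_norm.

Section schauder.
Context {R : realType} {X : completeNormedModType R}.
Implicit Types (M : nat -> set X) (u : nat -> X) (x : X).

Definition expansion M x u : Prop :=
  (forall n, u n \in M n) /\ series u @ \oo --> x.

Definition schauder_decomposition M : Prop :=
  (forall n, [/\ closed (M n), submod_closed [in M n] & M n != [set 0]]) /\
  (forall x, exists! u, expansion M x u).

(* The expansion of [x] is unique when [M] is a Schauder decomposition;
   otherwise the value is meaningless. *)
Definition ascp M (n : nat) (x : X) : X :=
  xget (fun=> 0) [set u | expansion M x u] n.

Definition finite_dimensional (V : set X) : Prop :=
  exists (d : nat) (b : 'I_d -> X),
    V = [set x | exists c : 'I_d -> R, x = \sum_(i < d) c i *: b i].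

End schauder.

(* Only the restriction of [Phi] to [0, +oo) is constrained, and only this
   restriction is used below. *)
Definition orlicz_function (R : realType) (Phi : R -> R) : Prop :=
  [/\ {within `[0, +oo[, continuous Phi},
      {in `[0, +oo[ &, {homo Phi : s t / s <= t}},
      convex_function (E := R^o) `[0, +oo[ Phi,
      (forall t : R, 0 <= t -> 0 <= Phi t)
    & Phi 0 = 0 /\ Phi t @[t --> +oo] --> +oo].

Local Open Scope ereal_scope.

(* The infimum is taken in the extended reals, so that it is [+oo], and not a
   default value, when no [rho] is admissible. *)
Definition orlicz_norm (R : realType) (Phi : R -> R) (a : nat -> R) : \bar R :=
  ereal_inf [set rho%:E | rho in
    [set rho : R | (0 < rho)%R /\ \sum_(0 <= n <oo) (Phi (a n / rho))%:E <= 1]].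

Definition schauder_orlicz_decomposition (R : realType)
    (X : completeNormedModType R) (M : nat -> set X) : Prop :=
  schauder_decomposition M /\
  exists Phi : R -> R, orlicz_function Phi /\
    forall x : X, orlicz_norm Phi (fun n => `|ascp M n x|%R) = `|x|%:E.

(* Main.v *)
From HB Require Import structures.
Require Import Defs.
From mathcomp Require Import all_boot all_order all_algebra.
From mathcomp Require Import all_classical all_reals all_analysis.
From mathcomp Require Import lra ring.
Import Order.TTheory GRing.Theory Num.Theory.
Import numFieldNormedType.Exports.
Local Open Scope classical_set_scope.
Local Open Scope ring_scope.

(** Let [P] be the coordinate projection onto a finite dimensional summand of a
    Schauder-Orlicz decomposition.  Replacing the corresponding coordinate of
    [x] by zero increases no term [Phi (|P_k x| / rho)], hence does not increase
    the norm ([le_orlicz_norm]): [1 - P] is a contraction.  But [C[0,1]] has the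
    Daugavet property, [|1 - P| = 1 + |P|] for every bounded [P] of finite rank,
    so that [P] would be zero, whereas it is the identity on a nonzero subspace.

    The part of the Daugavet property needed here is
    [finite_rank_contraction_eq0]: a linear [P] of finite rank with
    [|f - P f| <= |f|] for all [f] vanishes.  Near any point [t0] there are more
    disjoint tents than the rank of [P]; a nontrivial linear combination of them
    lies in the kernel of [P], and can be normalised into a function [h] with
    [|h| <= 1], with value 1 at some point [s] close to [t0], and supported near
    [t0] ([peaked_kernel]).  Write [Q = 1 - P], so that [Q h = h].

    - If [f] vanishes at [t0], then so does [Q f] ([contraction_local]):
      as [f] is at most some small [eta] on the support of [h], the norm of
      [e f + h] is at most [1 + e eta] for small [e], while [Q (e f + h)] has
      value [1 + e (Q f) s] at [s]; hence [(Q f) s <= eta], and symmetrically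
      for [- f].  Letting [s] tend to [t0] and [eta] to 0 gives [(Q f) t0 = 0].
    - For an arbitrary [f], the function [f - f(s) h] vanishes at [s] and has
      the same image under [P] as [f], so [P f] vanishes at [s].  Such points
      [s] are dense, and [P f = 0]. *)

(** * Normalised linear relations *)

(** The normalisation is by the entry of largest absolute value of a nonzero
    vector in the kernel of the matrix of coordinates. *)
Lemma peaked_relation (R : realType) (X : lmodType R) (d m : nat)
    (b : 'I_d -> X) (y : 'I_m -> X) :
  (d < m)%N ->
  (forall k, exists c : 'I_d -> R, y k = \sum_(i < d) c i *: b i) ->
  exists (c : 'I_m -> R) (j : 'I_m),
    [/\ c j = 1, forall k, `|c k| <= 1 & \sum_k c k *: y k = 0].
Proof.
move=> dm /choice[a ya].
pose A := \matrix_(k, i) a k i : 'M[R]_(m, d).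
have /rowV0Pn[v /sub_kermxP vA v0] : kermx A != 0.
  rewrite kermx_eq0 -row_leq_rank -ltnNge.
  exact: leq_ltn_trans (rank_leq_col A) dm.
have [k0 vk0] : exists k, v ord0 k != 0.
  apply/existsP; apply: contra_neqT v0 => /existsPn v0.
  by apply/rowP => k; rewrite mxE; apply/eqP; rewrite -[_ == _]negbK.
have [j _ jmax] := @arg_maxP _ _ _ k0 predT (fun k => `|v ord0 k|) isT.
have vj0 : 0 < `|v ord0 j|.
  by apply: lt_le_trans (jmax k0 isT); rewrite normr_gt0.
exists (fun k => v ord0 k / v ord0 j), j; split.
- by rewrite divff// -normr_gt0.
- by move=> k; rewrite normrM normfV ler_pdivrMr// mul1r; exact: jmax.
under eq_bigr do rewrite ya scaler_sumr.
rewrite exchange_big big1//= => i _.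
under eq_bigr do rewrite scalerA mulrAC.
rewrite -scaler_suml -mulr_suml.
have /matrixP/(_ ord0 i) := vA; rewrite !mxE => vAi.
under eq_bigr do rewrite -[a _ _](mxE matrix_key (fun k i => a k i)).
by rewrite vAi mul0r scale0r.
Qed.

Section continuous_functions.
Context {R : realType}.
Implicit Types (f g h : C01 R) (s t : unit_interval R).

(** * Tent functions *)

Lemma tent_continuous (c r : R) :
  continuous (fun t : unit_interval R => Num.max 0 (1 - `|\val t - c| / r)).
Proof.
move=> t.
have dist : {for t, continuous (fun t : unit_interval R => \val t - c)}.
  exact: (continuousB (@initial_continuous _ _ _ t) (@cst_continuous _ _ c t)).
have norm : {for t, continuous (fun t : unit_interval R => `|\val t - c|)}.
  exact: (continuous_comp dist (@norm_continuous _ _ _)).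
have slope : {for t, continuous (fun t : unit_interval R => `|\val t - c| / r)}.
  exact: (continuousM norm (@cst_continuous _ _ r^-1 t)).
have one : {for t, continuous (fun=> 1 : R)} by exact: cst_continuous.
have zero : {for t, continuous (fun=> 0 : R)} by exact: cst_continuous.
exact: (continuous_max zero (continuousB one slope)).
Qed.

Definition tent (c r : R) : C01 R := C01_of (@tent_continuous c r).

Lemma tent_top s r : tent (\val s) r s = 1.
Proof. by rewrite /= subrr normr0 mul0r subr0 max_r. Qed.

Lemma tent_bound c r t : 0 < r -> `|tent c r t| <= 1.
Proof.
move=> r0; have d0 : 0 <= `|\val t - c| / r by rewrite divr_ge0// ltW.
rewrite /= ger0_norm; last by rewrite le_max lexx.
by rewrite ge_max ler01/=; move: d0; lra.
Qed.

Lemma tent_support c r t : 0 < r -> tent c r t != 0 -> `|\val t - c| < r.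
Proof.
move=> r0; apply: contraNT; rewrite -leNgt -[leLHS]mul1r -ler_pdivlMr// => H.
by apply/eqP/max_l; rewrite subr_le0.
Qed.

(** The tents are centered at equally spaced points, on the side of [t0] where
    at least half of the unit interval lies. *)
Lemma disjoint_tents (t0 : unit_interval R) (delta : R) (m : nat) :
  0 < delta ->
  exists (b : 'I_m -> C01 R) (s : 'I_m -> unit_interval R),
    [/\ forall k, b k (s k) = 1,
        forall k t, `|b k t| <= 1,
        forall k t, b k t != 0 -> `|\val t - \val t0| < delta
      & forall k l t, b k t != 0 -> b l t != 0 -> k = l].
Proof.
move=> delta0.
(* The spacing [w] leaves room for [m + 1] steps from [t0]. *)
have [w [w0 wdelta w1]] : exists w : R,
    [/\ 0 < w, m.+1%:R * w < delta & m.+1%:R * w <= 1 / 2].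
  have m0 : 0 < m.+1%:R :> R by rewrite ltr0n.
  have min0 : 0 < Num.min delta 1 by rewrite lt_min delta0 ltr01.
  have min1 : Num.min delta 1 <= delta by rewrite ge_min lexx.
  have min2 : Num.min delta 1 <= 1 by rewrite ge_min lexx orbT.
  exists (Num.min delta 1 / 2 / m.+1%:R); split.
  - by rewrite !divr_gt0.
  - by rewrite mulrC divfK ?gt_eqF//; lra.
  - by rewrite mulrC divfK ?gt_eqF//; lra.
have kw (k : 'I_m) : 0 <= k%:R * w /\ k%:R * w + w <= m.+1%:R * w.
  split; first by rewrite mulr_ge0 ?ler0n ?ltW.
  rewrite -[X in _ + X]mul1r -mulrDl ler_pM2r// natr1 ler_nat ltnS.
  exact: ltnW.
have /andP[t00 t01] : 0 <= \val t0 <= 1.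
  by have := set_valP t0; rewrite /= in_itv.
(* From the left half of the interval the steps go to the right, and from the
   right half to the left. *)
have [sg [sg1 sgP]] : exists sg : R, `|sg| = 1 /\
    forall u : R, 0 <= u -> u <= 1 / 2 -> 0 <= \val t0 + sg * u <= 1.
  have [ht|ht] := leP (\val t0) (1 / 2).
    by exists 1; rewrite normr1; split=> // u ? ?; apply/andP; split; lra.
  exists (-1); rewrite normrN normr1; split=> // u ? ?.
  by apply/andP; split; lra.
have s01 (k : 'I_m) : \val t0 + sg * (k%:R * w) \in `[0, 1]%classic.
  have [k0 k1] := kw k.
  by rewrite inE /= in_itv/=; apply: sgP => //; lra.
pose s (k : 'I_m) : unit_interval R := SigSub (s01 k).
have w20 : 0 < w / 2 by rewrite divr_gt0.
exists (fun k => tent (\val (s k)) (w / 2)), s; split.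
- by move=> k; exact: tent_top.
- by move=> k t; exact: tent_bound.
- move=> k t /(tent_support _ _ _ w20) tk; have [k0 k1] := kw k.
  have -> : \val t - \val t0 = (\val t - \val (s k)) + sg * (k%:R * w).
    by rewrite /=; ring.
  apply: (le_lt_trans (ler_normD _ _)); rewrite normrM sg1 mul1r.
  by rewrite (ger0_norm k0); lra.
- move=> k l t /(tent_support _ _ _ w20) tk /(tent_support _ _ _ w20) tl.
  apply/eqP; apply: contraT => kl.
  have : w <= `|\val (s k) - \val (s l)|.
    have -> : \val (s k) - \val (s l) = sg * ((k%:R - l%:R) * w).
      by rewrite /=; ring.
    rewrite !normrM sg1 mul1r (gtr0_norm w0); apply: ler_peMl; first exact: ltW.
    have : (k < l)%N || (l < k)%N by rewrite -neq_ltn.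
    case/orP=> H; [rewrite distrC|]; rewrite -natrB ?(ltnW H)//.
      by rewrite normr_nat ler1n subn_gt0.
    by rewrite normr_nat ler1n subn_gt0.
  have := ler_distD (\val t) (\val (s k)) (\val (s l)).
  by rewrite (distrC (\val (s k)) (\val t)) => ? ?; lra.
Qed.

Lemma C01_epsilon_delta (g : C01 R) t0 (e : R) : 0 < e ->
  exists2 delta : R, 0 < delta &
    forall t, `|\val t - \val t0| < delta -> `|g t - g t0| < e.
Proof.
move=> e0.
have /(@cvgrPdist_lt _ _ _ (nbhs t0) (nbhs_filter t0))/(_ _ e0) :=
  @C01_continuous R g t0.
move=> /nbhs_ballP[delta /= delta0 H]; exists delta => // t tt0.
rewrite distrC; apply: H.
have : ball (\val t0) delta (\val t) by rewrite /ball/= distrC.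
exact.
Qed.

Lemma sum_C01E (I : Type) (r : seq I) (F : I -> C01 R) t :
  (\sum_(i <- r) F i) t = \sum_(i <- r) F i t.
Proof.
apply: (big_ind2 (fun (f : C01 R) x => f t = x)) => //.
by move=> f x g y <- <-.
Qed.

(** * Contractive complements of finite rank operators *)

Context (P : {linear C01 R -> C01 R}) (V : set (C01 R)).
Hypothesis finV : finite_dimensional V.
Hypothesis PV : forall f, V (P f).

(** More disjoint tents than the dimension of [V] have linearly dependent
    images; the relation between the images is a function of the kernel, whose
    values are controlled because at most one tent is nonzero at each point. *)
Lemma peaked_kernel t0 (delta : R) : 0 < delta ->
  exists (h : C01 R) (s : unit_interval R),
    [/\ P h = 0, h s = 1, forall t, `|h t| <= 1
      & forall t, h t != 0 -> `|\val t - \val t0| < delta].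
Proof.
move=> delta0; have [d [e Ve]] := finV.
have [b [s [bs b1 bdelta bdisj]]] := disjoint_tents t0 delta d.+1 delta0.
have Pb k : exists c : 'I_d -> R, P (b k) = \sum_(i < d) c i *: e i.
  by have := PV (b k); rewrite Ve.
have [c [j [cj c1 cP]]] := peaked_relation _ _ _ _ _ _ (ltnSn d) Pb.
have hE k t : b k t != 0 -> (\sum_k c k *: b k) t = c k * b k t.
  move=> bk; rewrite sum_C01E (bigD1 k)// big1 => [|l /andP[_ lk]].
    exact: addr0.
  rewrite C01_scaleE; have [->|bl] := eqVneq (b l t) 0; first by rewrite mulr0.
  by rewrite (bdisj _ _ _ bl bk) eqxx in lk.
have h0 t : (forall k, b k t = 0) -> (\sum_k c k *: b k) t = 0.
  by move=> b0; rewrite sum_C01E big1// => k _; rewrite C01_scaleE b0 mulr0.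
exists (\sum_k c k *: b k), (s j); split.
- by rewrite linear_sum/= -[RHS]cP; apply: eq_bigr => k _; rewrite linearZ.
- by rewrite (hE j) bs ?oner_neq0// mulr1.
- move=> t; have [[k bk]|bN] := pselect (exists k, b k t != 0).
    by rewrite (hE k)// normrM mulr_ile1.
  rewrite h0 ?normr0// => k; apply/eqP; apply: contraT => bk.
  by case: bN; exists k.
- move=> t ht; have [[k bk]|bN] := pselect (exists k, b k t != 0).
    exact: bdelta bk.
  rewrite h0 ?eqxx// in ht => k; apply/eqP; apply: contraT => bk.
  by case: bN; exists k.
Qed.

Hypothesis contr : forall f, `|f - P f| <= `|f|.

(** Adding a small multiple of [f] to a peaked function [h] of the kernel
    increases its norm by little, as [f] is small where [h] is large. *)
Lemma contraction_local_le f t0 (delta eta : R) : 0 < delta -> 0 < eta ->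
  (forall t, `|\val t - \val t0| < delta -> `|f t| <= eta) ->
  exists2 s, `|\val s - \val t0| < delta & `|(f - P f) s| <= eta.
Proof.
move=> delta0 eta0 feta.
have [h [s [Ph hs h1 hdelta]]] := peaked_kernel t0 delta delta0.
exists s; first by apply: hdelta; rewrite hs oner_neq0.
have eps0 : 0 < (1 + `|f|)^-1 by rewrite invr_gt0 ltr_wpDr.
(* The bound from above, to be used for both [f] and [- f]. *)
have half (g : C01 R) : (forall t, `|g t| <= `|f t|) -> (g - P g) s <= eta.
  move=> gf; set e := (1 + `|f|)^-1.
  (* This size of [e] makes [e *: g] harmless off the support of [h]. *)
  have e1 : e * `|f| <= 1 by rewrite mulrC ler_pdivrMr ?mul1r ?lerDr ?ltr_wpDr.
  have ub : `|e *: g + h| <= 1 + e * eta.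
    apply: C01_norm_le => t; rewrite C01_addE C01_scaleE.
    have eg : `|e * g t| <= e * `|f t|.
      by rewrite normrM (gtr0_norm eps0) ler_pM2l.
    have [ht|ht] := eqVneq (h t) 0.
      rewrite ht addr0 (le_trans eg)//.
      have : e * `|f t| <= e * `|f| by rewrite ler_pM2l//; exact: C01_norm_ub.
      have : 0 < e * eta by rewrite mulr_gt0.
      lra.
    apply: (le_trans (ler_normD _ _)); rewrite addrC; apply: lerD => //.
    by rewrite (le_trans eg)// ler_pM2l//; apply/feta/hdelta.
  have QE : e *: g + h - P (e *: g + h) = e *: (g - P g) + h.
    by rewrite linearD linearZ/= Ph addr0 addrAC -scalerBr.
  have := le_trans (C01_norm_ub _ s) (le_trans (contr (e *: g + h)) ub).
  move=> /(le_trans (ler_norm _)); rewrite QE (C01_addE _ h) C01_scaleE hs.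
  by rewrite addrC lerD2l ler_pM2l.
rewrite ler_norml half// andbT.
have := half (- f); rewrite linearN -opprD C01_oppE lerNl; apply=> t.
by rewrite C01_oppE normrN.
Qed.

(** Where [f] vanishes, so does the contraction [f - P f], by continuity of both
    functions and the previous estimate at points [s] tending to [t0]. *)
Lemma contraction_local f t0 : f t0 = 0 -> P f t0 = 0.
Proof.
move=> f0; suff : `|(f - P f) t0| <= 0.
  by rewrite normr_le0 C01_addE f0 add0r C01_oppE oppr_eq0 => /eqP.
apply/ler_addgt0Pl => e e0; rewrite addr0.
have e20 : 0 < e / 2 by rewrite divr_gt0.
have [d1 d10 fd] := C01_epsilon_delta f t0 _ e20.
have [d2 d20 gd] := C01_epsilon_delta (f - P f) t0 _ e20.
have d0 : 0 < Num.min d1 d2 by rewrite lt_min d10.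
have [t|s] := contraction_local_le f t0 _ _ d0 e20.
  by rewrite lt_min => /andP[/fd + _]; rewrite f0 subr0 => /ltW.
rewrite lt_min => /andP[_ /gd gs] ge.
have := ler_distD ((f - P f) s) ((f - P f) t0) 0.
by rewrite !subr0 (distrC ((f - P f) t0)); lra.
Qed.

(** A peaked function of the kernel allows the value of [f] at the peak to be
    cancelled without changing [P f]. *)
Lemma finite_rank_contraction_eq0 f : P f = 0.
Proof.
apply: C01P => t0; rewrite C01_zeroE; apply/eqP; apply: contraT => Pf0.
have e0 : 0 < `|P f t0| by rewrite normr_gt0.
have [delta delta0 Pfd] := C01_epsilon_delta (P f) t0 _ e0.
have [h [s [Ph hs _ hdelta]]] := peaked_kernel t0 delta delta0.
have Pg : P (f - f s *: h) = P f.
  by rewrite linearB linearZ/= Ph scaler0 subr0.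
have /contraction_local : (f - f s *: h) s = 0.
  by rewrite C01_addE C01_oppE C01_scaleE hs mulr1 subrr.
rewrite Pg => Pfs.
have : `|P f s - P f t0| < `|P f t0|.
  by apply: Pfd; apply: hdelta; rewrite hs oner_neq0.
by rewrite Pfs sub0r normrN ltxx.
Qed.

End continuous_functions.

(** * Monotonicity of the Luxemburg norm *)

Lemma le_orlicz_norm (R : realType) (Phi : R -> R) (a b : nat -> R) :
  orlicz_function Phi ->
  (forall n, 0 <= a n <= b n) -> (orlicz_norm Phi a <= orlicz_norm Phi b)%E.
Proof.
move=> [_ Phi_nd _ Phi0 _] ab; apply: ereal_inf_le_tmp.
move=> _ [rho [rho0 rho1] <-]; exists rho => //; split => //.
have ge0 n : 0 <= a n / rho.
  by have /andP[? _] := ab n; rewrite divr_ge0// ltW.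
apply: le_trans rho1; apply: lee_nneseries => n _.
  by rewrite lee_fin Phi0.
have /andP[_ abn] := ab n.
have abr : a n / rho <= b n / rho by rewrite ler_pM2r ?invr_gt0.
by rewrite lee_fin; apply: Phi_nd => //; rewrite in_itv/= andbT//
  (le_trans (ge0 n)).
Qed.

(** * Coordinate projections of a Schauder decomposition *)

Section schauder.
Context {R : realType} {X : completeNormedModType R} {M : nat -> set X}.
Hypothesis SM : schauder_decomposition M.

Lemma ascpP x : expansion M x (fun n => ascp M n x).
Proof.
have [u [ux _]] := SM.2 x.
by have := @xgetPex _ (fun=> 0) [set u | expansion M x u] (ex_intro _ u ux).
Qed.

Lemma ascp_unique x u : expansion M x u -> forall n, ascp M n x = u n.
Proof.
move=> ux n; have [v [_ vuniq]] := SM.2 x.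
by rewrite -(vuniq _ ux) (vuniq _ (ascpP x)).
Qed.

Lemma ascp_linear n : linear (ascp M n).
Proof.
move=> a x y; apply: (ascp_unique (a *: x + y)
  (fun k => a *: ascp M k x + ascp M k y)).
have [Mx cx] := ascpP x; have [My cy] := ascpP y; split.
  by move=> k; have [_ [_ Mlin] _] := SM.1 k; exact: Mlin.
rewrite (_ : series _ = (fun k => a *: series (fun k => ascp M k x) k
    + series (fun k => ascp M k y) k)).
  by apply: cvgD => //; apply: cvgZr.
by apply/funext => k; rewrite /series/= big_split/= scaler_sumr.
Qed.

Lemma expansion_single n v : M n v ->
  expansion M v (fun k => if k == n then v else 0).
Proof.
move=> Mv; split.
  move=> k; case: eqP => [->|_]; first exact/mem_set.
  by have [_ [M0 _] _] := SM.1 k.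
apply: cvg_near_cst; exists n.+1 => // m /= nm.
by rewrite /series/= big_mkord (bigD1 (Ordinal nm))//= eqxx big1 ?addr0// => k;
  rewrite -val_eqE/= => /negPf ->.
Qed.

Lemma ascp_id n v : M n v -> ascp M n v = v.
Proof.
by move=> Mv; rewrite (ascp_unique _ _ (expansion_single _ _ Mv)) eqxx.
Qed.

Lemma ascp_in n x : M n (ascp M n x).
Proof. by have [/(_ n)/set_mem] := ascpP x. Qed.

Lemma ascp_ascp n k x :
  ascp M k (ascp M n x) = if k == n then ascp M n x else 0.
Proof. exact: (ascp_unique _ _ (expansion_single _ _ (ascp_in n x))). Qed.

Lemma ascp_neq0 n : exists2 v, M n v & v != 0.
Proof.
have [_ [M0 _] /eqP Mn0] := SM.1 n.
have [//|H] := pselect (exists2 v, M n v & v != 0).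
case: Mn0; apply/seteqP; split=> [v Mv|_ ->]; last exact: set_mem.
by apply/eqP; apply: contraT => v0; case: H; exists v.
Qed.

End schauder.

(** * Schauder-Orlicz decompositions of the space of continuous functions *)

Theorem theorem28 (R : realType) :
  ~ exists M : nat -> set (C01 R),
      schauder_orlicz_decomposition M /\ exists n, finite_dimensional (M n).
Proof.
move=> [M [[SM [Phi [oPhi normE]]] [n fin]]].
pose P : {linear C01 R -> C01 R} :=
  HB.pack (ascp M n)
    (GRing.isLinear.Build _ _ _ _ (ascp M n) (ascp_linear SM n)).
have [v Mv /eqP] := ascp_neq0 SM n; apply.
rewrite -(ascp_id SM _ _ Mv).
apply: (finite_rank_contraction_eq0 P (M n) fin) => f; first exact: ascp_in.
rewrite -lee_fin -!normE; apply: le_orlicz_norm => // k.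
rewrite normr_ge0/= /P/=.
have L := ascp_linear SM k.
have -> : ascp M k (f - ascp M n f) = ascp M k f - ascp M k (ascp M n f).
  by rewrite addrC -scaleN1r L scaleN1r addrC.
by rewrite ascp_ascp//; case: eqP => [->|_]; rewrite ?subrr ?normr0 ?subr0.
Qed.
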